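(* Let $n\ge 1$ and let $A=[a_{ij}]\in\mathbb{R}^{n\times n}$ be an essentially ultrametric matrix. Algorithm 1 (Ultrametric Tree Construction, described in the context), given $A$ as input, terminates after $2n-1$ recursion calls (calls of the procedure TreeRecursion, including the initial call on $r$), and its output is a rooted directed tree $(V,E)$ in which each vertex can be reached from the root $r$ by a unique directed path. Moreover, the tree $(V,E)$, together with the index sets $I(u)\subseteq\{1,\ldots,n\}$ and values $f(u)\in\mathbb{R}$ that the algorithm assigns to the vertices $u\in V$, has the following properties. (1) The submatrix $A_{I(u)}$ is essentially ultrametric for each $u\in V$. (2) For each $i\in\{1,\ldots,n\}$, there is a leaf $u\in V$ with $I(u)=\{i\}$ and $f(u)=a_{ii}$. (3) If $u\in V$ has a child $v$, then $f(u)=a_{ij}$ for all $i\in I(v)$ and all $j\in I(u)\setminus I(v)$.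
   Context: A nonnegative (entrywise) symmetric matrix $A=[a_{ij}]\in\mathbb{R}^{n\times n}$ is called essentially ultrametric if $a_{ij}\ge\min\{a_{ik},a_{kj}\}$ for all $i,j,k$ with $i\neq j\neq k\neq i$ (pairwise distinct indices). No condition relates the diagonal entries to the off-diagonal entries. For an index set $I\subseteq\{1,\ldots,n\}$, $A_I$ denotes the submatrix of $A$ with rows and columns indexed by $I$. Algorithm 1 (Ultrametric Tree Construction). Input: an essentially ultrametric matrix $A=[a_{ij}]\in\mathbb{R}^{n\times n}$. Output: a directed graph $(V,E)$, each vertex $u\in V$ carrying an index set $I(u)$ and a value $f(u)$. Initialize $V\gets\{r\}$, $E\gets\emptyset$, $I(r)\gets\{1,\ldots,n\}$, and call TreeRecursion($r$). The procedure TreeRecursion($u$) does the following. Set $i\gets\min I(u)$. - If $|I(u)|=1$: set $f(u)\gets a_{ii}$ and return. - Otherwise: set $f(u)\gets\min\{a_{ij}: j\in I(u)\setminus\{i\}\}$; create two new vertices $v,w$ and set $V\gets V\cup\{v,w\}$, $E\gets E\cup\{(u,v),(u,w)\}$; set $I(v)\gets\{j\in I(u): a_{ij}>f(u)\}\cup\{i\}$ and $I(w)\gets\{j\in I(u)\setminus\{i\}: a_{ij}=f(u)\}$; call TreeRecursion($v$), then TreeRecursion($w$). An edge $(u,v)\in E$ is directed from the parent $u$ to its child $v$; a leaf is a vertex without children. *)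

(* Defs.v *)
From mathcomp Require Import all_boot all_order all_algebra.
Set Implicit Arguments.
Unset Strict Implicit.
Unset Printing Implicit Defensive.
Import Order.TTheory GRing.Theory Num.Theory.
Local Open Scope ring_scope.

Definition essentially_ultrametric (R : realFieldType) (n : nat)
    (A : 'M[R]_n) : Prop :=
  [/\ forall i j, 0 <= A i j,
      A^T = A &
      forall i j k, i != j -> j != k -> k != i ->
        Num.min (A i k) (A k j) <= A i j].

Definition submatrix (R : realFieldType) (n : nat) (A : 'M[R]_n)
    (J : {set 'I_n}) : 'M[R]_#|J| :=
  mxsub (@enum_val _ (mem J)) (@enum_val _ (mem J)) A.

(* A minimizer of g over J, or None if J is empty. *)
Definition arg_min_in (T : finType) (d : Order.disp_t) (X : orderType d)
    (J : {set T}) (g : T -> X) : option T :=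
  [pick j in J | [forall k in J, (g j <= g k)%O]].

(* The variables of the algorithm, and the number of calls made so far. The
   value f(u) is None until it is assigned; the index set I(u) is only
   meaningful on the vertices created so far. *)
Record state (R : realFieldType) (n : nat) (T : eqType) := State {
  vertices : seq T;
  edges : seq (T * T);
  index_set : T -> {set 'I_n};
  value : T -> option R;
  calls : nat }.

(* [new s] is the vertex created when the existing vertices are those of s, so
   it is meant to satisfy [new s \notin s].
   [fuel] bounds the recursion depth. The result is Some S when the call of
   the procedure on u, started in state s, terminates within that depth in
   state S; this S does not depend on [fuel]. The result is None when the
   depth is exceeded or when one of the two minima ranges over an empty set. *)
Fixpoint tree_recursion (R : realFieldType) (n : nat) (T : eqType)
    (new : seq T -> T) (A : 'M[R]_n) (fuel : nat) (u : T)
    (s : state R n T) {struct fuel} : option (state R n T) :=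
  if fuel is depth.+1 then
    let: State V E idx f c := s in
    if arg_min_in (idx u) (@nat_of_ord n) is Some i then
      if #|idx u| == 1%N then
        Some (State V E idx [eta f with u |-> Some (A i i)] c.+1)
      else if arg_min_in (idx u :\ i) (A i) is Some j0 then
        let fu := A i j0 in
        let v := new V in
        let w := new (v :: V) in
        let Iv := [set j in idx u | A i j > fu] :|: [set i] in
        let Iw := [set j in idx u :\ i | A i j == fu] in
        let s1 := State (w :: v :: V) ((u, v) :: (u, w) :: E)
                    [eta idx with v |-> Iv, w |-> Iw]
                    [eta f with u |-> Some fu] c.+1 in
        if tree_recursion new A depth v s1 is Some s2
        then tree_recursion new A depth w s2
        else None
      else None
    else None
  else None.

Definition initial_state (R : realFieldType) (n : nat) (T : eqType) (r : T) :
    state R n T :=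
  State [:: r] [::] [fun _ : T => set0 with r |-> [set: 'I_n]]
    (fun=> None) 0.

Definition tree_construction_outputs (R : realFieldType) (n : nat)
    (T : eqType) (new : seq T -> T) (r : T) (A : 'M[R]_n)
    (S : state R n T) : Prop :=
  exists fuel, tree_recursion new A fuel r (initial_state R n r) = Some S.

(* p lists the vertices after x. Repetitions are allowed, so uniqueness of p is
   uniqueness among all walks; a unique p is necessarily repetition-free. *)
Definition directed_path (T : eqType) (E : seq (T * T)) (x y : T)
    (p : seq T) : Prop :=
  path (fun a b => (a, b) \in E) x p /\ last x p = y.

Definition rooted_directed_tree (T : eqType) (r : T) (V : seq T)
    (E : seq (T * T)) : Prop :=
  [/\ r \in V,
      forall u v, (u, v) \in E -> u \in V /\ v \in V,
      forall u, (u, r) \notin E,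
      forall v, v \in V -> v != r -> exists! u, (u, v) \in E &
      forall v, v \in V -> exists p, directed_path E r v p].

Definition leaf (T : eqType) (V : seq T) (E : seq (T * T)) (u : T) : Prop :=
  u \in V /\ forall v, (u, v) \notin E.

(* Main.v *)
Require Import Defs.
From mathcomp Require Import all_boot all_order all_algebra.
From mathcomp Require Import zify.
Set Implicit Arguments.
Unset Strict Implicit.
Unset Printing Implicit Defensive.
Import Order.TTheory GRing.Theory Num.Theory.
Local Open Scope ring_scope.

(** The algorithm is divide and conquer, and the whole content of the theorem
    is that one division is sound. Let J be the current index set, i its least
    element and a the least entry A i j with j in J different from i. The
    indices with A i j > a, together with i, form the near part, those with
    A i j = a the far part; they partition J into two nonempty sets. For k near
    and different from i, and l far, the triple i, k, l has A i k > a = A i l,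
    and the ultrametric inequality says that the least of the three entries of
    a triple is attained twice, so A k l = a ([split_entry]). Thus every entry
    between the two parts equals the value given to the vertex, which is what
    is claimed about its edges; symmetry of A gives it for either child.

    A call on J therefore makes one call plus those on two parts whose sizes
    add up to the size of J, and 1 + (2k - 1) + (2l - 1) = 2(k + l) - 1. The
    remaining properties are kept by hanging two disjoint trees below a new
    root ([represents_join]), because every index of J lies in exactly one part.

    [tree_recursion_represents] is the induction. Its hypothesis is about a
    call started in an arbitrary state, since the second recursive call runs in
    the state left by the first one; what makes the two results combine is that
    a call only adds fresh vertices and, among the vertices already present,
    changes the value of its own argument and no index set.

    Being essentially ultrametric passes to every principal submatrix, and in a
    rooted directed tree the path to a vertex is unique because it can be read
    backwards along unique parents. *)

(** * Rooted directed trees *)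

Lemma rooted_directed_tree_eq_mem (T : eqType) (r : T) (V V' : seq T)
    (E E' : seq (T * T)) :
  V =i V' -> E =i E' ->
  rooted_directed_tree r V E -> rooted_directed_tree r V' E'.
Proof.
move=> eqV eqE [rV EV Er par reach]; split.
- by rewrite -eqV.
- by move=> u v; rewrite -eqE -!eqV; apply: EV.
- by move=> u; rewrite -eqE.
- move=> v; rewrite -eqV => vV /(par v vV) [u [uv u_uniq]].
  by exists u; split=> [|x]; rewrite -eqE //; apply: u_uniq.
- move=> v; rewrite -eqV => /reach [p [pE p_last]].
  by exists p; split=> //; rewrite -(eq_path (fun a b => eqE (a, b))).
Qed.

Lemma rooted_directed_tree1 (T : eqType) (r : T) :
  rooted_directed_tree r [:: r] [::].
Proof.
split=> //; first by rewrite inE.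
- by move=> v; rewrite inE => ->.
- by move=> v; rewrite inE => /eqP ->; exists [::].
Qed.

(** Grafting a disjoint tree below a vertex: its root had no parent and gets
    exactly one, while all other vertices keep theirs. *)
Lemma rooted_directed_tree_graft (T : eqType) (r u v : T) (V V' : seq T)
    (E E' : seq (T * T)) :
  u \in V -> {in V', forall x, x \notin V} ->
  rooted_directed_tree r V E -> rooted_directed_tree v V' E' ->
  rooted_directed_tree r (V ++ V') ((u, v) :: E ++ E').
Proof.
move=> uV disj [rV EV Er par reach] [vV' EV' Ev par' reach'].
have notin x : x \in V -> x \notin V'.
  by move=> xV; apply/negP => /disj; rewrite xV.
split.
- by rewrite mem_cat rV.
- move=> x y; rewrite inE !mem_cat => /or3P[/eqP[-> ->]|/EV[-> ->]|/EV'[-> ->]].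
  + by rewrite uV vV' orbT.
  + by [].
  + by rewrite !orbT.
- move=> x; rewrite inE mem_cat !negb_or Er /=; apply/andP; split.
    by apply/eqP=> -[_ rv]; move: (notin _ rV); rewrite rv vV'.
  by apply/negP=> /EV'[_ rV']; move: (notin _ rV); rewrite rV'.
- move=> y; rewrite mem_cat => /orP[yV /(par y yV)|yV' _].
    move=> [x [xy x_uniq]]; exists x; split=> [|z].
      by rewrite inE mem_cat xy orbT.
    rewrite inE mem_cat => /or3P[/eqP[_ yv]|/x_uniq //|/EV'[_ yV']].
      by move: (notin _ yV); rewrite yv vV'.
    by move: (notin _ yV); rewrite yV'.
  have [->|yv] := eqVneq y v.
    exists u; split=> [|z]; first by rewrite inE eqxx.
    rewrite inE mem_cat => /or3P[/eqP[->] //|/EV[_ vV]|].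
      by move: (notin _ vV); rewrite vV'.
    by rewrite (negPf (Ev z)).
  have [x [xy x_uniq]] := par' y yV' yv; exists x; split=> [|z].
    by rewrite inE mem_cat xy !orbT.
  rewrite inE mem_cat => /or3P[/eqP[_ /eqP]|/EV[_ yV]|/x_uniq //].
    by rewrite (negPf yv).
  by move: (notin _ yV); rewrite yV'.
- have mono (F : seq (T * T)) x p : {subset F <= (u, v) :: E ++ E'} ->
      path (fun a b => (a, b) \in F) x p ->
      path (fun a b => (a, b) \in (u, v) :: E ++ E') x p.
    by move=> sub; apply: sub_path => a b /sub.
  have subE : {subset E <= (u, v) :: E ++ E'}.
    by move=> e eE; rewrite inE mem_cat eE orbT.
  have subE' : {subset E' <= (u, v) :: E ++ E'}.
    by move=> e eE; rewrite inE mem_cat eE !orbT.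
  move=> y; rewrite mem_cat => /orP[/reach [p [pE p_y]]|/reach' [q [qE q_y]]].
    by exists p; split=> //; apply: mono pE.
  have [p [pE p_u]] := reach u uV.
  exists (p ++ v :: q); split; last by rewrite last_cat.
  by rewrite cat_path /= p_u mem_head /= (mono _ _ _ subE pE) (mono _ _ _ subE' qE).
Qed.

(** Two paths with the same ends agree from the end backwards, since parents
    are unique; they start together because no edge enters the root. *)
Lemma rooted_directed_tree_path_unique (T : eqType) (r : T) (V : seq T)
    (E : seq (T * T)) :
  rooted_directed_tree r V E ->
  forall v, v \in V -> exists! p, directed_path E r v p.
Proof.
move=> [rV EV Er par reach] v /reach [p rp]; exists p; split=> // q.
elim/last_ind: p v q rp => [|p x IHp] v q [].
  move=> _ /= <- [qE]; case/lastP: q qE => // q y.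
  by rewrite last_rcons rcons_path => /andP[_ yE] yr; rewrite yr (negPf (Er _)) in yE.
rewrite rcons_path last_rcons => /andP[pE px] <- [].
case/lastP: q => [_ /= rx|q y].
  by rewrite -rx (negPf (Er _)) in px.
rewrite rcons_path last_rcons => /andP[qE] /[swap] -> qx.
have xr : x != r by apply/eqP => xr; rewrite xr (negPf (Er _)) in px.
have [z [_ par_x]] := par x (EV _ _ px).2 xr.
congr rcons; apply: (IHp (last r p)); split=> //.
by rewrite -(par_x _ px) -(par_x _ qx).
Qed.

(** * Essentially ultrametric matrices and the split of an index set *)

Lemma essentially_ultrametric_submatrix (R : realFieldType) (n : nat)
    (A : 'M[R]_n) (J : {set 'I_n}) :
  essentially_ultrametric A -> essentially_ultrametric (submatrix A J).
Proof.
move=> [ge0 symA ultra]; split.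
- by move=> i j; rewrite mxE.
- by rewrite -{2}symA; apply/matrixP=> i j; rewrite !mxE.
- move=> i j k ij jk ki; rewrite !mxE; apply: ultra.
  + by rewrite (inj_eq enum_val_inj).
  + by rewrite (inj_eq enum_val_inj).
  + by rewrite (inj_eq enum_val_inj).
Qed.

(** Minima over nonempty sets exist, so the algorithm never fails for lack of a
    minimizer. *)
Lemma arg_min_inP (T : finType) (d : Order.disp_t) (X : orderType d)
    (J : {set T}) (g : T -> X) :
  J != set0 ->
  exists j, [/\ arg_min_in J g = Some j, j \in J &
                {in J, forall k, (g j <= g k)%O}].
Proof.
case/set0Pn=> x xJ; rewrite /arg_min_in; case: pickP => [j|none].
  by case/andP=> jJ /forall_inP j_min; exists j.
have [j jJ j_min] := @Order.TotalTheory.arg_minP d X T x (mem J) g xJ.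
by have /negP[] := negbT (none j); rewrite [j \in J]jJ; apply/forall_inP.
Qed.

Section Split.
Variables (R : realFieldType) (n : nat) (A : 'M[R]_n) (J : {set 'I_n}).
Variables (i j0 : 'I_n).
Hypotheses (iJ : i \in J) (j0J : j0 \in J :\ i).
Hypothesis j0_min : {in J :\ i, forall k, A i j0 <= A i k}.

(** The index sets of the two children, in the form in which the algorithm
    computes them; [j0] stands for the minimizer of [A i] on [J :\ i]. *)
Definition near_part := [set j in J | A i j > A i j0] :|: [set i].
Definition far_part := [set j in J :\ i | A i j == A i j0].

(** Minimality of [A i j0] makes [>] and [=] complementary on [J :\ i]. *)
Lemma far_part_setD : far_part = J :\: near_part.
Proof.
apply/setP=> k; rewrite !inE negb_or negb_and.
have [->|ki] := eqVneq k i; first by rewrite /= andbF.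
have [kJ|_] := boolP (k \in J); last by [].
have := @j0_min k; rewrite !inE ki kJ => /(_ isT) le_k.
by rewrite /= -leNgt eq_le le_k !andbT.
Qed.

Lemma near_part_sub : near_part \subset J.
Proof. by apply/subsetP=> k; rewrite !inE => /orP[/andP[]|/eqP->]. Qed.

Lemma near_part_setD : near_part = J :\: far_part.
Proof. by rewrite far_part_setD setDDr setDv set0U; apply/esym/setIidPr/near_part_sub. Qed.

Lemma mem_near_part : i \in near_part.
Proof. by rewrite !inE eqxx orbT. Qed.

Lemma mem_far_part : j0 \in far_part.
Proof. by rewrite inE eqxx andbT. Qed.

Lemma card_split : (#|near_part| + #|far_part| = #|J|)%N.
Proof. by rewrite far_part_setD -{1}(setIidPr near_part_sub) cardsID. Qed.

(** If [k] is not [i] itself, the smallest of the three entries joining [i], [k]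
    and [l] occurs twice; since [A i k] exceeds [A i l = A i j0], the repeated
    one is [A k l = A i l]. *)
Lemma split_entry : essentially_ultrametric A ->
  {in near_part & far_part, forall k l, A k l = A i j0}.
Proof.
move=> [_ symA ultra] k l kN.
have sym a b : A a b = A b a by rewrite -{1}symA mxE.
move=> lF; have: k != l.
  by apply/eqP=> kl; move: lF; rewrite far_part_setD -kl inE kN.
move: kN lF; rewrite !inE.
have [-> _ /andP[_ /eqP]//|ki] := eqVneq k i.
rewrite orbF => /andP[kJ ik] /andP[/andP[li lJ] /eqP il] kl.
apply/le_anti/andP; split.
  have := ultra i l k; rewrite eq_sym li eq_sym kl ki => /(_ isT isT isT).
  by rewrite il ge_min leNgt ik.
have := ultra k l i kl li; rewrite eq_sym ki => /(_ isT).
by rewrite (sym k i) il min_r // ltW.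
Qed.

End Split.

(** * Trees representing a matrix *)

(** The part of the conclusion that is meaningful for the subtree built by one
    recursive call. The second and fourth fields tie the tree to the set [J] on
    which the call was made, which is what the parent needs from its children. *)
Record represents (R : realFieldType) (n : nat) (A : 'M[R]_n) (T : eqType)
    (J : {set 'I_n}) (r : T) (V : seq T) (E : seq (T * T))
    (I : T -> {set 'I_n}) (f : T -> option R) : Prop := Represents {
  represents_tree : rooted_directed_tree r V E;
  represents_root : I r = J;
  represents_value : {in V, forall x, exists a, f x = Some a};
  represents_leaf : {in J, forall i, exists x,
    leaf V E x /\ I x = [set i] /\ f x = Some (A i i)};
  represents_edge : forall x y, (x, y) \in E ->
    {in I y & I x :\: I y, forall i j, f x = Some (A i j)} }.

(** [I] and [f] matter on [V] only. Hence a subtree still represents [A] after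
    later calls have extended these functions to new vertices, and the order in
    which vertices and edges were listed is irrelevant. *)
Lemma represents_eq (R : realFieldType) (n : nat) (A : 'M[R]_n) (T : eqType)
    (J : {set 'I_n}) (r : T) (V V' : seq T) (E E' : seq (T * T))
    (I I' : T -> {set 'I_n}) (f f' : T -> option R) :
  V =i V' -> E =i E' -> {in V, I' =1 I} -> {in V, f' =1 f} ->
  represents A J r V E I f -> represents A J r V' E' I' f'.
Proof.
move=> eqV eqE eqI eqf [tree rI val leaves edge].
have [rV EV _ _ _] := tree; split.
- exact: rooted_directed_tree_eq_mem tree.
- by rewrite eqI.
- by move=> x; rewrite -eqV => xV; rewrite eqf //; apply: val.
- move=> i /leaves [x [[xV xE] [Ix fx]]]; exists x.
  by rewrite eqI // eqf // /leaf -eqV; split=> //; split=> // y; rewrite -eqE.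
- move=> x y; rewrite -eqE => xyE; have [xV yV] := EV _ _ xyE.
  by rewrite !eqI // eqf //; apply: edge.
Qed.

Lemma represents1 (R : realFieldType) (n : nat) (A : 'M[R]_n) (T : eqType)
    (i : 'I_n) (r : T) (I : T -> {set 'I_n}) (f : T -> option R) :
  I r = [set i] -> f r = Some (A i i) ->
  represents A [set i] r [:: r] [::] I f.
Proof.
move=> Ir fr; split=> //.
- exact: rooted_directed_tree1.
- by move=> x; rewrite inE => /eqP->; exists (A i i).
- move=> j; rewrite inE => /eqP->; exists r.
  by split=> //; split=> //; rewrite inE.
Qed.

(** One step of the recursion, seen from its result. Only the two edges leaving
    the new root are not already covered by the subtrees; their property is the
    hypothesis on the entries between [K] and [L], read in both directions
    thanks to the symmetry of [A]. Leaves stay leaves because the sources of the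
    edges of a subtree lie in that subtree. *)
Lemma represents_join (R : realFieldType) (n : nat) (A : 'M[R]_n) (T : eqType)
    (J K L : {set 'I_n}) (a : R) (u v w : T) (V1 V2 : seq T)
    (E1 E2 : seq (T * T)) (I : T -> {set 'I_n}) (f : T -> option R) :
  A^T = A -> K = J :\: L -> L = J :\: K -> {in K & L, forall i j, A i j = a} ->
  u \notin V1 -> u \notin V2 -> {in V2, forall x, x \notin V1} ->
  I u = J -> f u = Some a ->
  represents A K v V1 E1 I f -> represents A L w V2 E2 I f ->
  represents A J u (u :: V1 ++ V2) ((u, v) :: (u, w) :: E1 ++ E2) I f.
Proof.
move=> symA defK defL entry uV1 uV2 disj Iu fu.
move=> [tree1 Iv val1 leaf1 edge1] [tree2 Iw val2 leaf2 edge2].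
have [_ EV1 _ _ _] := tree1; have [_ EV2 _ _ _] := tree2.
split=> //.
- have disj1 : {in V1, forall x, x \notin [:: u]}.
    by move=> x xV1; rewrite inE; apply: contraNneq uV1 => <-.
  (* Both subtrees are grafted, in turn, onto the one-vertex tree [u]. *)
  have tree_uv :=
    rooted_directed_tree_graft (mem_head u _) disj1 (rooted_directed_tree1 u) tree1.
  have disj2 : {in V2, forall x, x \notin [:: u] ++ V1}.
    move=> x xV2; rewrite inE negb_or disj // andbT.
    by apply: contraNneq uV2 => <-.
  apply: rooted_directed_tree_eq_mem
    (rooted_directed_tree_graft (mem_head u _) disj2 tree_uv tree2).
    by move=> x; rewrite /= -cat1s.
  by move=> e; rewrite /= !inE; apply: orbCA.
- move=> x; rewrite inE mem_cat => /or3P[/eqP->|/val1 //|/val2 //].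
  by exists a.
- have new_leaf x : x != u -> (x \in V1 -> forall y, (x, y) \notin E1) ->
      (x \in V2 -> forall y, (x, y) \notin E2) ->
      forall y, (x, y) \notin (u, v) :: (u, w) :: E1 ++ E2.
    move=> xu xE1 xE2 y; rewrite !inE mem_cat !xpair_eqE (negPf xu) /=.
    apply/orP=> -[xy|xy].
      by have [xV _] := EV1 _ _ xy; move: (xE1 xV y); rewrite xy.
    by have [xV _] := EV2 _ _ xy; move: (xE2 xV y); rewrite xy.
  move=> i iJ; have [iK|iNK] := boolP (i \in K).
    have [x [[xV xE] Ifx]] := leaf1 i iK; exists x; split=> //; split.
      by rewrite inE mem_cat xV orbT.
    apply: new_leaf => //; first by apply: contraNneq uV1 => <-.
    by move=> /disj; rewrite xV.
  have iL : i \in L by rewrite defL inE iNK.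
  have [x [[xV xE] Ifx]] := leaf2 i iL; exists x; split=> //; split.
    by rewrite inE mem_cat xV !orbT.
  apply: new_leaf => //; first by apply: contraNneq uV2 => <-.
  by move=> xV1; move: (disj _ xV); rewrite xV1.
- move=> x y; rewrite !inE mem_cat => /or4P[/eqP[-> ->]|/eqP[-> ->]|/edge1 //|/edge2 //].
    by rewrite Iu Iv -defL fu => i j iK jL; rewrite entry.
  rewrite Iu Iw -defK fu => i j iL jK.
  by rewrite -symA mxE entry.
Qed.

(** * The algorithm *)

(** Induction on the depth. Depth [#|J|] suffices because both parts of a split
    are nonempty, hence smaller than [J]. The clauses on the old vertices are
    what the caller needs to recognise, in the final state, its own data and the
    subtree built by the first recursive call. *)
Lemma tree_recursion_represents (R : realFieldType) (n : nat) (A : 'M[R]_n)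
    (T : eqType) (new : seq T -> T) :
  essentially_ultrametric A -> (forall s : seq T, new s \notin s) ->
  forall fuel u (s : state R n T),
    u \in vertices s -> index_set s u != set0 ->
    (#|index_set s u| <= fuel)%N ->
    exists N D I f,
      [/\ tree_recursion new A fuel u s =
            Some (State (N ++ vertices s) (D ++ edges s) I f
                    (calls s + (2 * #|index_set s u| - 1))),
          {in N, forall x, x \notin vertices s},
          {in vertices s, I =1 index_set s},
          {in vertices s, forall x, x != u -> f x = value s x} &
          represents A (index_set s u) u (u :: N) D I f].
Proof.
move=> ultra fresh; elim=> [|fuel IH] u [V E I f c] /= uV.
  by rewrite leqn0 cards_eq0 => /negPf->.
move=> J0 cardJ; set J := I u in J0 cardJ *.
have [i [-> iJ _]] := arg_min_inP (@nat_of_ord n) J0.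
case: ifP => [/cards1P[k defJ]|/negbT cardJ1].
  have ki : k = i by move: iJ; rewrite defJ inE => /eqP.
  exists [::], [::], I, [eta f with u |-> Some (A i i)]; split=> //.
  - by rewrite defJ cards1 /= addn1.
  - by move=> x xV /= /negPf ->.
  - by rewrite defJ ki; apply: represents1; rewrite -?ki //= eqxx.
have J1 : J :\ i != set0.
  by apply: contraNneq cardJ1 => Ji0; rewrite (cardsD1 i) iJ Ji0 cards0.
have [j0 [-> j0J j0_min]] := arg_min_inP (A i) J1.
rewrite -/(near_part A J i j0) -/(far_part A J i j0).
have card_sum := card_split iJ j0_min.
have inN := mem_near_part A J i j0; have inF := mem_far_part A j0J.
set K := near_part A J i j0 in card_sum inN *.
set L := far_part A J i j0 in card_sum inF *.
have K0 : K != set0 by apply/set0Pn; exists i.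
have L0 : L != set0 by apply/set0Pn; exists j0.
have K_gt0 : (0 < #|K|)%N by rewrite card_gt0.
have L_gt0 : (0 < #|L|)%N by rewrite card_gt0.
(* Abstracted from the cardinals, whose underlying finite types are convertible
   but not syntactically equal from one hypothesis to the next. *)
have arith k l m : (0 < k -> 0 < l -> k + l = m -> m <= fuel.+1 ->
    [/\ k <= fuel, l <= fuel &
        c.+1 + (2 * k - 1) + (2 * l - 1) = c + (2 * m - 1)])%N.
  by move=> *; split; lia.
have [K_le L_le callsE] := arith _ _ _ K_gt0 L_gt0 card_sum cardJ.
set v := new V; set w := new (v :: V).
have vV : v \notin V := fresh V.
have [wv wV] : w != v /\ w \notin V.
  by apply/andP; have := fresh (v :: V); rewrite inE negb_or.
have uv : u != v by apply: contraNneq vV => <-.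
have uw : u != w by apply: contraNneq wV => <-.
set s1 := State (w :: v :: V) _ _ _ _.
have Iv : index_set s1 v = K by rewrite /= eqxx.
have Iw : index_set s1 w = L by rewrite /= (negPf wv) eqxx.
have [] := IH v s1; rewrite ?Iv //.
- by rewrite /= !inE eqxx orbT.
move=> N1 [D1 [I1 [f1 [-> N1new I1E f1E rep1]]]].
set s2 := State (N1 ++ _) _ _ _ _.
have s1_s2 : {subset w :: v :: V <= vertices s2}.
  by move=> x xs1; rewrite /= mem_cat xs1 orbT.
have ws2 : w \in vertices s2 by rewrite s1_s2 ?mem_head.
have I2w : index_set s2 w = L by rewrite /= I1E ?Iw // mem_head.
have [] := IH w s2; rewrite ?I2w //.
move=> N2 [D2 [I2 [f2 [-> N2new I2E f2E rep2]]]].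
have V_s1 x : x \in V -> x \in w :: v :: V by rewrite !inE => ->; rewrite !orbT.
have old x : x \in V -> x != v /\ x != w.
  by move=> xV; split; [apply: contraNneq vV|apply: contraNneq wV] => <-.
have I2old x : x \in V -> I2 x = I x.
  move=> xV; have [xv xw] := old x xV.
  rewrite I2E /= ?s1_s2 ?V_s1 // I1E ?V_s1 //=.
  by rewrite (negPf xv) (negPf xw).
have f2old x : x \in V -> f2 x = [eta f with u |-> Some (A i j0)] x.
  move=> xV; have [xv xw] := old x xV.
  by rewrite f2E ?s1_s2 ?V_s1 //= f1E ?V_s1.
exists (N2 ++ N1 ++ [:: w; v]), (D2 ++ D1 ++ [:: (u, v); (u, w)]), I2, f2.
split=> //.
- rewrite /= -!catA /=; congr (Some (State _ _ _ _ _)); exact: callsE.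
- move=> x; rewrite !mem_cat => /or3P[/N2new|/N1new|].
  + by apply: contra => xV; rewrite s1_s2 // V_s1.
  + by apply: contra; apply: V_s1.
  + by rewrite !inE => /orP[]/eqP->.
- by move=> x xV xu; rewrite f2old //= (negPf xu).
have V1_s2 : {subset v :: N1 <= vertices s2}.
  move=> x; rewrite inE /= mem_cat => /orP[/eqP->|->//].
  by rewrite !inE eqxx !orbT.
have wN1 : w \notin v :: N1.
  by rewrite inE negb_or wv; apply/negP => /N1new; rewrite /= mem_head.
apply: (@represents_eq _ _ _ _ _ _ (u :: (v :: N1) ++ w :: N2) _
  ((u, v) :: (u, w) :: D1 ++ D2) _ I2 _ f2) => //.
- by move=> x; rewrite !(inE, mem_cat); do !case: (_ \in _) => //; do !case: (_ == _).
- by move=> x; rewrite !(inE, mem_cat); do !case: (_ \in _) => //; do !case: (_ == _).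
(* The first subtree was built before the second call, so its data must be
   carried over to the final state; [w], whose value that call sets, is not
   among its vertices. *)
apply: (@represents_join _ _ _ _ J K L (A i j0)) => //.
- by case: ultra.
- exact: near_part_setD.
- exact: far_part_setD.
- exact: split_entry.
- by rewrite inE negb_or uv; apply/negP => /N1new; rewrite /= V_s1.
- by rewrite inE negb_or uw; apply/negP => /N2new; rewrite s1_s2 // V_s1.
- move=> x; rewrite [x \in w :: _]inE => /orP[/eqP-> //|/N2new].
  by apply: contra; apply: V1_s2.
- exact: I2old.
- by rewrite f2old //= eqxx.
- apply: represents_eq rep1 => // x xV1; first by rewrite I2E // V1_s2.
  by rewrite f2E ?V1_s2 //; apply: contraNneq wN1 => <-.
Qed.

Theorem theorem2p4 (R : realFieldType) (n : nat) (n_ge1 : (1 <= n)%N)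
    (A : 'M[R]_n) (A_ultra : essentially_ultrametric A)
    (T : eqType) (new : seq T -> T)
    (new_fresh : forall s : seq T, new s \notin s) (r : T) :
  exists S : state R n T,
    let V := vertices S in
    let E := edges S in
    let I := index_set S in
    let f := value S in
    tree_construction_outputs new r A S
    /\ calls S = (2 * n - 1)%N
    /\ rooted_directed_tree r V E
    /\ (forall u, u \in V -> exists! p : seq T, directed_path E r u p)
    /\ (forall u, u \in V -> exists x : R, f u = Some x)
    /\ (forall u, u \in V -> essentially_ultrametric (submatrix A (I u)))
    /\ (forall i : 'I_n, exists u : T,
          leaf V E u /\ I u = [set i] /\ f u = Some (A i i))
    /\ (forall u v : T, u \in V -> (u, v) \in E ->
          forall i j : 'I_n, i \in I v -> j \in I u :\: I v ->
            f u = Some (A i j)).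
Proof.
have Ir : index_set (initial_state R n r) r = [set: 'I_n] by rewrite /= eqxx.
have card_r : #|index_set (initial_state R n r) r| = n by rewrite Ir cardsT card_ord.
have [] := tree_recursion_represents A_ultra new_fresh (fuel := n)
  (u := r) (s := initial_state R n r).
- exact: mem_head.
- by rewrite -card_gt0 card_r.
- by rewrite card_r.
move=> N [D [I [f [run _ _ _]]]]; rewrite card_r Ir /= cats0 in run *.
move=> rep; exists (State (N ++ [:: r]) D I f (0 + (2 * n - 1))).
have eqV : r :: N =i N ++ [:: r] by move=> x; rewrite mem_cat !inE orbC.
have [tree _ val leaves edge] := represents_eq eqV (fun _ => erefl)
  (fun _ _ => erefl) (fun _ _ => erefl) rep.
split; first by exists n.
split=> //; split=> //; split; first exact: rooted_directed_tree_path_unique.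
split; first exact: val.
split; first by move=> u _; apply: essentially_ultrametric_submatrix.
split; first by move=> i; apply: leaves; rewrite inE.
by move=> u v _ uv i j; apply: edge.
Qed.
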